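(* Let $\mathcal{H}$ be a real Hilbert space, let $A:\mathcal{H}\rightrightarrows\mathcal{H}$ be maximal monotone with $A^{-1}(0)=\{x\in\mathcal{H}: 0\in Ax\}\neq\emptyset$, let $\theta>0$, let $p\geq 1$ be an integer, and let $x_0\in\Omega:=\{x\in\mathcal{H}: 0\notin Ax\}$. Then there exists $t_0>0$ such that the closed-loop control system \[ \dot{x}(t)+x(t)-(I+\lambda(t)A)^{-1}x(t)=0,\qquad \lambda(t)\,\|(I+\lambda(t)A)^{-1}x(t)-x(t)\|^{p-1}=\theta,\qquad x(0)=x_0, \] has a unique solution $(x,\lambda):[0,t_0]\to\mathcal{H}\times(0,+\infty)$. Moreover, $x(\cdot)$ is continuously differentiable and $\lambda(\cdot)$ is locally Lipschitz continuous.
   Context: $(I+\lambda A)^{-1}$ denotes the resolvent of $A$ of index $\lambda>0$ (single-valued and defined on all of $\mathcal{H}$ since $A$ is maximal monotone). For $p\geq 2$ and $x\in\Omega$, the map $\lambda\mapsto \lambda^{1/(p-1)}\|x-(I+\lambda A)^{-1}x\|$ is a continuous strictly increasing bijection from $[0,\infty)$ onto $[0,\infty)$, so the second equation determines $\lambda(t)$ uniquely from $x(t)$ whenever $x(t)\in\Omega$; for $p=1$ it reads $\lambda(t)=\theta$. *)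

(* Defs.v *)
From HB Require Import structures.
From mathcomp Require Import all_boot all_order all_algebra.
From mathcomp Require Import all_classical all_reals all_analysis.
Set Implicit Arguments. Unset Strict Implicit. Unset Printing Implicit Defensive.
Import Order.TTheory GRing.Theory Num.Theory.
Import numFieldNormedType.Exports.
Local Open Scope classical_set_scope.
Local Open Scope ring_scope.

(* A real Hilbert space: a complete normed space whose norm comes from an
   inner product [inner]. *)
Definition is_inner_product {R : realType} {H : normedModType R}
  (inner : H -> H -> R) : Prop :=
  [/\ (forall x y, inner x y = inner y x),
      (forall a x y z, inner (a *: x + y) z = a * inner x z + inner y z) &
      (forall x, inner x x = `|x| ^+ 2)].

Definition monotone_op {R : realType} {H : normedModType R}
  (inner : H -> H -> R) (A : H -> set H) : Prop :=
  forall x y u v, A x u -> A y v -> 0 <= inner (u - v) (x - y).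

Definition maximal_monotone {R : realType} {H : normedModType R}
  (inner : H -> H -> R) (A : H -> set H) : Prop :=
  monotone_op inner A /\
  forall B : H -> set H, monotone_op inner B ->
    (forall x, A x `<=` B x) -> B = A.

(* The resolvent (I + lam A)^{-1} x: the y with x ∈ y + lam A y
   (unique and existing when A is maximal monotone and lam > 0). *)
Definition resolvent {R : realType} {H : normedModType R}
  (A : H -> set H) (lam : R) (x : H) : H :=
  xget x [set y | exists v, A y v /\ x = y + lam *: v].

Definition has_deriv_within {R : realType} {H : normedModType R}
  (D : set R) (f : R -> H) (t : R) (v : H) : Prop :=
  (fun s => (s - t)^-1 *: (f s - f t)) @ within (fun s => D s /\ s != t) (nbhs t)
    --> v.

(* Main.v *)
Require Import Defs.
From HB Require Import structures.
From mathcomp Require Import all_boot all_order all_algebra.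
From mathcomp Require Import all_classical all_reals all_analysis.
From mathcomp Require Import ring lra.
Set Implicit Arguments. Unset Strict Implicit. Unset Printing Implicit Defensive.
Import Order.TTheory GRing.Theory Num.Theory.
Import numFieldNormedType.Exports.
Local Open Scope classical_set_scope.
Local Open Scope ring_scope.

(* The control is eliminated: if [lam |F lam x|^q = theta], where [F lam x] is the
   displacement [x - (I + lam A)^-1 x], then the step length [|F lam x|] is a
   1-Lipschitz function of [x], because for fixed [x] it is nondecreasing in [lam]
   whereas [lam = theta / |F lam x|^q] is decreasing in it.  Hence, where the step
   length is bounded away from 0, [lam] and the vector field [- F lam x] are Lipschitz
   functions of [x], and the Picard-Lindelof theorem applies; the 1-Lipschitz bound
   also confines every solution starting at [x0] to a small ball for short times.

   That resolvents are everywhere defined (Minty's theorem) is obtained from the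
   proximal point of the Fitzpatrick function of [A]. *)

(** * Inner product calculus, Cauchy-Schwarz, joint continuity *)

Section InnerProduct.
Context (R : realType) (H : normedModType R) (inner : H -> H -> R).
Hypothesis innerP : is_inner_product inner.

Lemma innerC x y : inner x y = inner y x.
Proof. by case: innerP. Qed.

Lemma inner_norm x : inner x x = `|x| ^+ 2.
Proof. by case: innerP. Qed.

Lemma innerDl x y z : inner (x + y) z = inner x z + inner y z.
Proof. by case: innerP => _ /(_ 1 x y z); rewrite scale1r mul1r. Qed.

Lemma inner0l z : inner 0 z = 0.
Proof. by have := innerDl 0 0 z; rewrite addr0; lra. Qed.

Lemma innerZl a x z : inner (a *: x) z = a * inner x z.
Proof. by case: innerP => _ /(_ a x 0 z); rewrite addr0 inner0l addr0. Qed.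

Lemma innerNl x z : inner (- x) z = - inner x z.
Proof. by rewrite -scaleN1r innerZl mulN1r. Qed.

Lemma innerDr x y z : inner z (x + y) = inner z x + inner z y.
Proof. by rewrite innerC innerDl !(innerC _ z). Qed.

Lemma innerZr a x z : inner z (a *: x) = a * inner z x.
Proof. by rewrite innerC innerZl innerC. Qed.

Lemma innerNr x z : inner z (- x) = - inner z x.
Proof. by rewrite innerC innerNl innerC. Qed.

Lemma inner0r z : inner z 0 = 0.
Proof. by rewrite innerC inner0l. Qed.

Definition innerE := (innerDl, innerDr, innerNl, innerNr, innerZl, innerZr).

Lemma inner_ge0 x : 0 <= inner x x.
Proof. by rewrite inner_norm sqr_ge0. Qed.

Lemma normr_sqrD x y : `|x + y| ^+ 2 = `|x| ^+ 2 + 2 * inner x y + `|y| ^+ 2.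
Proof. by rewrite -!inner_norm !innerE (innerC y x); lra. Qed.

Lemma inner_le x y : inner x y <= `|x| * `|y|.
Proof.
have [->|x0] := eqVneq x 0; first by rewrite inner0l normr0 mul0r.
have [->|y0] := eqVneq y 0; first by rewrite inner0r normr0 mulr0.
have X : 0 < `|x| by rewrite normr_gt0.
have Y : 0 < `|y| by rewrite normr_gt0.
(* The expansion equals [2 * |x| * |y| * (|x| * |y| - inner x y)], from which the positive factor is
   cancelled. *)
have := inner_ge0 (`|y| *: x - `|x| *: y).
rewrite !innerE !inner_norm (innerC y x) => h.
have : 0 <= (`|x| * `|y|) * (`|x| * `|y| - inner x y) by lra.
by rewrite pmulr_rge0 ?mulr_gt0// subr_ge0.
Qed.

Lemma ler_norm_inner x y : `|inner x y| <= `|x| * `|y|.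
Proof.
by rewrite ler_norml inner_le andbT -[inner x y]opprK lerN2 -innerNl -(normrN x) inner_le.
Qed.

Lemma cvg_inner {T : Type} (F : set_system T) {FF : Filter F} (f g : T -> H) x y :
  f @ F --> x -> g @ F --> y -> inner (f t) (g t) @[t --> F] --> inner x y.
Proof.
move=> fx gy; apply/cvgrPdist_le => e e0.
have C0 : 0 < `|x| + `|y| + 1 by have := normr_ge0 x; have := normr_ge0 y; lra.
near=> t.
have d1 : `|x - f t| <= Num.min 1 (e / (2 * (`|x| + `|y| + 1))).
  by near: t; apply: cvgr_dist_le fx _ _; rewrite lt_min ltr01 divr_gt0 ?mulr_gt0.
have d2 : `|y - g t| <= Num.min 1 (e / (2 * (`|x| + `|y| + 1))).
  by near: t; apply: cvgr_dist_le gy _ _; rewrite lt_min ltr01 divr_gt0 ?mulr_gt0.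
have -> : inner x y - inner (f t) (g t) = inner (x - f t) y + inner (f t) (y - g t).
  by rewrite !innerE; lra.
have ft : `|f t| <= `|x| + 1.
  have := ler_normD (f t - x) x; rewrite subrK distrC.
  by move: d1; rewrite le_min => /andP[d1 _]; lra.
move: d1 d2; rewrite !le_min => /andP[_ d1] /andP[_ d2].
set d := e / _ in d1 d2.
have d0 : 0 <= d by rewrite divr_ge0 ?mulr_ge0 ?ltW.
have de : d * (`|x| + `|y| + 1) = e / 2 by rewrite /d; field; lra.
have := ler_norm_inner (x - f t) y; have := ler_norm_inner (f t) (y - g t).
have := ler_pM (normr_ge0 _) (normr_ge0 y) d1 (lexx _).
have := ler_pM (normr_ge0 _) (normr_ge0 _) ft d2.
have := ler_normD (inner (x - f t) y) (inner (f t) (y - g t)).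
by lra.
Unshelve. all: by end_near. Qed.

End InnerProduct.

(** * Minimisation of strongly convex functions *)

Lemma cvgn_rate (R : realType) (V : completeNormedModType R) (u : nat -> V) (b : nat -> R) :
  b n @[n --> \oo] --> 0 -> (forall n k, (n <= k)%N -> `|u n - u k| <= b n) ->
  exists l, u n @[n --> \oo] --> l /\ forall n, `|u n - l| <= b n.
Proof.
move=> b0 ub.
have cu : cvgn u.
  apply/cauchy_cvgP/cauchy_exP => e e0.
  have [N _ Nb] := cvgr_lt 0 b0 e e0.
  exists (u N), N => //= n /= Nn.
  by rewrite -ball_normE/= (le_lt_trans (ub _ _ Nn))// Nb/=.
exists (limn u); split => // n.
have h : `|u n - u k| @[k --> \oo] --> `|u n - limn u|.
  by apply: cvg_norm; apply: cvgB => //; exact: cvg_cst.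
rewrite -(cvg_lim _ h)//; apply: limr_le; first by apply/cvg_ex; eexists; exact: h.
by exists n => // k /= nk; exact: ub.
Qed.

(** Turns minimality along a segment, after division by [t], into a first-order condition. *)
Lemma ge0_of_perturbation (R : realFieldType) (X D : R) : 0 <= D ->
  (forall t, 0 < t <= 1 -> 0 <= X + t * D) -> 0 <= X.
Proof.
move=> D0 h; rewrite leNgt; apply/negP => X0.
have DX : 0 < 2 * (D - X) by lra.
(* For this [t] one has [t * D <= - X / 2], so [X + t * D <= X / 2 < 0]. *)
have /h : 0 < - X / (2 * (D - X)) <= 1.
  by rewrite divr_gt0 ?oppr_gt0//= ler_pdivrMr//; lra.
have : - X / (2 * (D - X)) * (2 * (D - X)) = - X by rewrite divfK// gt_eqF.
set t := _ / _ => tE; nra.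
Qed.

Section Minimization.
Context (R : realType) (H : completeNormedModType R) (inner : H -> H -> R).
Hypothesis innerP : is_inner_product inner.

(* Minimising sequences of the strongly convex function [r + (|y|^2 + |v|^2) / 2]
   are Cauchy, so no weak compactness is needed; the conclusion is the
   first-order optimality condition at the minimiser. *)
Lemma prox_exists (E : H -> H -> R -> Prop) (m : R) :
  (exists y v r, E y v r) ->
  (forall t y v r y' v' r', 0 < t <= 1 -> E y v r -> E y' v' r' ->
     E (y + t *: (y' - y)) (v + t *: (v' - v)) (r + t * (r' - r))) ->
  (forall (y_ v_ : nat -> H) (r_ : nat -> R) y v r,
     (forall n, E (y_ n) (v_ n) (r_ n)) ->
     y_ n @[n --> \oo] --> y -> v_ n @[n --> \oo] --> v ->
     r_ n @[n --> \oo] --> r -> E y v r) ->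
  (forall y v r, E y v r -> m <= r + (`|y| ^+ 2 + `|v| ^+ 2) / 2) ->
  exists y0 v0 r0, E y0 v0 r0 /\
    forall y v r, E y v r -> r0 <= r + inner y0 (y - y0) + inner v0 (v - v0).
Proof.
move=> [y1 [v1 [r1 E1]]] Econv Eclosed Elb.
pose val (z : H * H * R) := z.2 + (`|z.1.1| ^+ 2 + `|z.1.2| ^+ 2) / 2.
pose EE (z : H * H * R) := E z.1.1 z.1.2 z.2.
pose S := [set val z | z in EE].
have Sinf : has_inf S.
  split; first by exists (val (y1, v1, r1)), (y1, v1, r1).
  by exists m => _ [z zE <-]; exact: Elb.
pose mm := inf S.
have mm_le z : EE z -> mm <= val z.
  by move=> zE; apply: ge_inf; [exact: (proj2 Sinf)|exists z].
have /choice[z zP] (n : nat) : exists z, EE z /\ val z <= mm + n.+1%:R^-1.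
  have [|_ [z zE <-] /ltW zlt] := @inf_adherent R S n.+1%:R^-1 _ Sinf.
    by rewrite invr_gt0.
  by exists z.
have sqrN (a b : H) : `|a + 2^-1 *: (b - a)| ^+ 2 =
    `|a| ^+ 2 / 2 + `|b| ^+ 2 / 2 - `|a - b| ^+ 2 / 4.
  by rewrite -!(inner_norm innerP) !(innerE innerP) (innerC innerP b a); lra.
(* The midpoint of two near-minimisers is feasible, hence has value at least [mm]; its value is the
   average of the two minus an eighth of the squared distance, and the average exceeds [mm] by at
   most [1 / n.+1]. *)
have dist n k : (n <= k)%N ->
    `|(z n).1.1 - (z k).1.1| ^+ 2 + `|(z n).1.2 - (z k).1.2| ^+ 2 <= 8 * n.+1%:R^-1.
  move=> nk.
  have /mm_le : EE ((z n).1.1 + 2^-1 *: ((z k).1.1 - (z n).1.1),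
                    (z n).1.2 + 2^-1 *: ((z k).1.2 - (z n).1.2),
                    (z n).2 + 2^-1 * ((z k).2 - (z n).2)).
    by apply: Econv; [lra|exact: (zP n).1|exact: (zP k).1].
  rewrite /val /= !sqrN.
  have := (zP n).2; have := (zP k).2; rewrite /val.
  have : k.+1%:R^-1 <= n.+1%:R^-1 :> R by rewrite lef_pV2 ?posrE ?ltr0n// ler_nat.
  by move: (k.+1%:R^-1) (n.+1%:R^-1) => dk dn; lra.
have b0 : Num.sqrt (8 * n.+1%:R^-1) @[n --> \oo] --> (0 : R).
  rewrite -(sqrtr0 R); apply: continuous_cvg; first exact: sqrt_continuous.
  by rewrite -(mulr0 8); apply: cvgMr; exact: cvg_harmonic.
have le_sqrt (a c : R) : 0 <= a -> a ^+ 2 <= c -> a <= Num.sqrt c.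
  by move=> a0 ac; rewrite -(ger0_norm a0) -sqrtr_sqr ler_wsqrtr.
have [|y0 [cy _]] := @cvgn_rate R H (fun n => (z n).1.1) _ b0.
  move=> n k nk; apply: le_sqrt => //; apply: le_trans (dist _ _ nk).
  by rewrite lerDl sqr_ge0.
have [|v0 [cv _]] := @cvgn_rate R H (fun n => (z n).1.2) _ b0.
  move=> n k nk; apply: le_sqrt => //; apply: le_trans (dist _ _ nk).
  by rewrite lerDr sqr_ge0.
have cval : val (z n) @[n --> \oo] --> mm.
  apply: (@squeeze_cvgr _ _ _ _ (fun=> mm) (fun n => mm + n.+1%:R^-1)).
  - by near=> n; rewrite mm_le ?(zP n).2//; exact: (zP n).1.
  - exact: cvg_cst.
  - by rewrite -[X in _ --> X](addr0 mm); apply: cvgD; [exact: cvg_cst|exact: cvg_harmonic].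
have sqr_cvg (w : nat -> H) l : w n @[n --> \oo] --> l ->
    `|w n| ^+ 2 @[n --> \oo] --> `|l| ^+ 2.
  move=> wl; rewrite -(inner_norm innerP).
  under eq_cvg do rewrite -(inner_norm innerP).
  exact: cvg_inner.
(* Chosen so that the limit point has value exactly [mm]; the third components converge because the
   values and the squared norms do. *)
pose r0 := mm - (`|y0| ^+ 2 + `|v0| ^+ 2) / 2.
have cr : (z n).2 @[n --> \oo] --> r0.
  have -> : (fun n => (z n).2) =
      (fun n => val (z n) - (`|(z n).1.1| ^+ 2 + `|(z n).1.2| ^+ 2) / 2).
    by apply/funext => n; rewrite /val addrK.
  by apply: cvgB => //; apply: cvgMl; apply: cvgD; exact: sqr_cvg.
have E0 : E y0 v0 r0 by apply: Eclosed cy cv cr => n; exact: (zP n).1.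
exists y0, v0, r0; split=> // y v r Eyv.
rewrite -subr_ge0.
apply: (@ge0_of_perturbation _ _ ((`|y - y0| ^+ 2 + `|v - v0| ^+ 2) / 2)).
  by rewrite divr_ge0 ?addr_ge0 ?sqr_ge0.
move=> t t01.
have /mm_le : EE (y0 + t *: (y - y0), v0 + t *: (v - v0), r0 + t * (r - r0)).
  exact: Econv t01 E0 Eyv.
rewrite -[X in X <= _](subrK ((`|y0| ^+ 2 + `|v0| ^+ 2) / 2)) -/r0 /val.
have /andP[t0 _] := t01.
rewrite /= !(normr_sqrD innerP _ (t *: _)) !normrZ !exprMn !(innerZr innerP).
by rewrite (gtr0_norm t0) -(pmulr_rge0 _ t0); lra.
Unshelve. all: by end_near. Qed.

End Minimization.

(** * Minty's theorem and Riesz representation *)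

Section Minty.
Context (R : realType) (H : completeNormedModType R) (inner : H -> H -> R).
Hypothesis innerP : is_inner_product inner.

(** Adjoining the pair [(y, v)] to the graph keeps it monotone, so by maximality it was there
    already. *)
Lemma maximal_monotone_mem (A : H -> set H) y v : maximal_monotone inner A ->
  (forall a b, A a b -> 0 <= inner (v - b) (y - a)) -> A y v.
Proof.
move=> [Amon Amax] h.
pose B a := A a `|` [set u | a = y /\ u = v].
suff <- : B = A by right.
apply: Amax => [a a' u u' [Au|[-> ->]] [Au'|[-> ->]]|a u]; last by left.
- exact: Amon.
- by rewrite -opprB -(opprB y) (innerNl innerP) (innerNr innerP) opprK h.
- exact: h.
- by rewrite !subrr (inner0l innerP).
Qed.

(* Fitzpatrick's argument: [E] is the epigraph of the Fitzpatrick function of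
   [A], and the optimality condition at its proximal point [(y0, v0)] forces
   [(- v0, - y0)] to be monotonically related to [A]. *)
Lemma minty_at0 (A : H -> set H) : monotone_op inner A ->
  (forall y v, (forall a b, A a b -> 0 <= inner (v - b) (y - a)) -> A y v) ->
  (exists a b, A a b) -> exists y v, A y v /\ y + v = 0.
Proof.
move=> Amon Amax [a0 [b0 Aab0]].
pose E y v r := forall a b, A a b -> inner y b + inner a v - inner a b <= r.
have innerE := innerE innerP; have innerC := innerC innerP.
have EA a b : A a b -> E a b (inner a b).
  by move=> Aab c d /(Amon _ _ _ _ Aab); rewrite !innerE !(innerC _ a) !(innerC _ c); lra.
(* If [r < inner y v], the Fitzpatrick inequality makes [(y, v)] monotonically related to [A], hence
   a graph point; testing [E] at that very point gives [inner y v <= r]. *)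
have Eyv y v r : E y v r -> inner y v <= r.
  move=> Er; rewrite leNgt; apply/negP => rlt.
  suff /Er : A y v by rewrite addrK leNgt rlt.
  apply: Amax => a b /Er; rewrite !innerE !(innerC _ y) !(innerC _ a) => h.
  by move: rlt; rewrite (innerC y v); lra.
have sqrD y v : inner y v + (`|y| ^+ 2 + `|v| ^+ 2) / 2 = `|y + v| ^+ 2 / 2.
  by rewrite (normr_sqrD innerP); lra.
have [||||y0 [v0 [r0 [E0 opt]]]] := @prox_exists R H inner innerP E 0.
- by exists a0, b0, (inner a0 b0); exact: EA.
- move=> t y v r y' v' r' /andP[t0 t1] h h' a b Aab.
  have u0 : 0 <= 1 - t by rewrite subr_ge0.
  have := ler_wpM2l u0 (h _ _ Aab); have := ler_wpM2l (ltW t0) (h' _ _ Aab).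
  by rewrite !innerE; lra.
- move=> y_ v_ r_ y v r h cy cv cr a b Aab.
  apply: ler_cvg_to cr _; last by near=> n; exact: h Aab.
  apply: cvgB; last exact: cvg_cst.
  by apply: cvgD; apply: cvg_inner => //; exact: cvg_cst.
- move=> y v r /Eyv yvr.
  have := sqr_ge0 `|y + v|; have := sqrD y v; lra.
(* The optimality condition at [(a, b)] together with [inner y0 v0 <= r0] bounds
   [inner (- y0 - b) (- v0 - a)] below by [|y0 + v0|^2]. *)
have : A (- v0) (- y0).
  apply: Amax => a b Aab; have := opt _ _ _ (EA _ _ Aab); have := Eyv _ _ _ E0.
  have := sqrD y0 v0; have := sqr_ge0 `|y0 + v0|.
  rewrite !innerE !(inner_norm innerP) (innerC b v0) (innerC b a) (innerC y0 a) (innerC y0 v0); lra.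
move=> A0; exists (- v0), (- y0); split=> //.
(* Optimality tested at the new graph point reads [r0 <= inner y0 v0 - |y0 + v0|^2], while
   [inner y0 v0 <= r0]. *)
have := opt _ _ _ (EA _ _ A0); have := Eyv _ _ _ E0.
have := sqrD y0 v0.
rewrite !innerE !(inner_norm innerP) !(innerC v0 y0) => h1 h2 h3.
have : `|y0 + v0| ^+ 2 <= 0 by lra.
by rewrite real_exprn_even_le0//= normr_eq0 -opprD addrC => /eqP ->; rewrite oppr0.
Unshelve. all: by end_near. Qed.

(** Translating the argument by [x] and scaling the values by [lam] preserves maximal monotonicity
    and reduces the claim to [minty_at0]. *)
Lemma minty (A : H -> set H) (lam : R) (x : H) : maximal_monotone inner A ->
  (exists a b, A a b) -> 0 < lam -> exists y v, A y v /\ x = y + lam *: v.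
Proof.
move=> Amax [a0 [b0 A0]] lam0.
have lamK (u : H) : lam *: (lam^-1 *: u) = u by rewrite scalerA divff ?gt_eqF// scale1r.
have lamVK (u : H) : lam^-1 *: (lam *: u) = u by rewrite scalerA mulVf ?gt_eqF// scale1r.
have scale_ge0 (u y : H) : (0 <= inner (lam^-1 *: u) y) = (0 <= inner u y).
  by rewrite (innerZl innerP) pmulr_rge0// invr_gt0.
have [|||y [u [Ayu yu0]]] := @minty_at0 (fun y u => A (x + y) (lam^-1 *: u)).
- move=> a a' u u' Au Au'; rewrite -scale_ge0 scalerBr.
  by have := Amax.1 _ _ _ _ Au Au'; rewrite opprD addrACA subrr add0r.
- move=> y u h; apply: maximal_monotone_mem => // a b Aab.
  have := h (a - x) (lam *: b); rewrite addrC subrK lamVK => /(_ Aab).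
  by rewrite -scale_ge0 scalerBr lamVK opprB addrA (addrC y).
- by exists (a0 - x), (lam *: b0); rewrite addrC subrK lamVK.
- by exists (x + y), (lam^-1 *: u); rewrite lamK -addrA yu0 addr0.
Qed.

(** The representing vector minimises [|y|^2 / 2 - l y]; the second component of [prox_exists] is
    frozen at 0. Completing the square gives the lower bound [- C^2 / 2]. *)
Lemma riesz (l : H -> R) (C : R) :
  (forall a x y, l (a *: x + y) = a * l x + l y) ->
  (forall x, l x <= C * `|x|) -> exists v, forall x, l x = inner v x.
Proof.
move=> llin lC.
have l0 : l 0 = 0 by have := llin 1 0 0; rewrite scale1r addr0; lra.
have lZ a x : l (a *: x) = a * l x by rewrite -[a *: x]addr0 llin l0 addr0.
have lD x y : l (x + y) = l x + l y by rewrite -[x]scale1r llin mul1r scale1r.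
have lN x : l (- x) = - l x by rewrite -scaleN1r lZ mulN1r.
pose E (y v : H) r := v = 0 /\ r = - l y.
have [||||v [w [r [[w0 ->] opt]]]] := @prox_exists R H inner innerP E (- C ^+ 2 / 2).
- by exists 0, 0, 0; split; rewrite // l0 oppr0.
- move=> t y u r y' u' r' _ [-> ->] [-> ->]; split; first by rewrite subrr scaler0 addr0.
  by rewrite lD lZ lD lN; lra.
- move=> y_ v_ r_ y u r h cy cv cr.
  have lcvg : l (y_ n) @[n --> \oo] --> l y.
    have lb n : `|l y - l (y_ n)| <= C * `|y - y_ n|.
      by rewrite -lN -lD ler_norml lC andbT lerNl -lN -(normrN (y - _)) lC.
    apply/cvgrPdist_le => e e0; have [C0|C0] := leP C 0.
      by near=> n; rewrite (le_trans (lb n))// (le_trans _ (ltW e0))// mulr_le0_ge0.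
    near=> n; rewrite (le_trans (lb n))// -ler_pdivlMl//; near: n.
    by apply: cvgr_dist_le cy _ _; rewrite mulr_gt0 ?invr_gt0.
  split.
    have vE : v_ = fun=> 0 by apply/funext => n; rewrite (h n).1.
    by apply: (cvg_unique _ cv); [exact: norm_hausdorff|rewrite vE; exact: cvg_cst].
  have rE : r_ = fun n => - l (y_ n) by apply/funext => n; rewrite (h n).2.
  by apply: (cvg_unique _ cr); [exact: norm_hausdorff|rewrite rE; exact: cvgN].
- move=> y u r [-> ->]; rewrite normr0.
  have := lC y; have := sqr_ge0 (C - `|y|); rewrite sqrrB; nra.
- exists v => x.
  (* Testing optimality at [v + x] and [v - x] yields the two opposite inequalities. *)
  have := opt _ _ _ (conj erefl erefl : E (v + x) 0 (- l (v + x))).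
  have := opt _ _ _ (conj erefl erefl : E (v - x) 0 (- l (v - x))).
  rewrite w0 !subrr !(inner0l innerP) !lD lN [v + x]addrC [v - x]addrC !addrK.
  by rewrite (innerNr innerP); lra.
Unshelve. all: by end_near. Qed.

End Minty.

(** * Resolvent estimates in the point and in the index *)

Section Resolvent.
Context (R : realType) (H : completeNormedModType R) (inner : H -> H -> R).
Hypothesis innerP : is_inner_product inner.
Context (A : H -> set H).
Hypotheses (Amax : maximal_monotone inner A) (A_neq0 : exists a b, A a b).

(** For [lam > 0] this is [lam] times the Yosida approximation of [A]. *)
Definition displacement (lam : R) (x : H) : H := x - resolvent A lam x.

Lemma resolventE lam x : resolvent A lam x = x - displacement lam x.
Proof. by rewrite /displacement subKr. Qed.

(** Minty's theorem makes the set behind [xget] nonempty, so the default value is never what defines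
    the resolvent. *)
Lemma resolvent_spec lam x : 0 < lam ->
  exists v, A (resolvent A lam x) v /\ displacement lam x = lam *: v.
Proof.
move=> lam0; have [y yP] := minty innerP x Amax A_neq0 lam0.
have [v [Av xE]] := @xgetPex _ x [set y | exists v, A y v /\ x = y + lam *: v] (ex_intro _ y yP).
by exists v; split=> //; rewrite /displacement [X in X - _]xE addrAC subrr add0r.
Qed.

Lemma displacement_neq0 lam x : 0 < lam -> ~ A x 0 -> displacement lam x != 0.
Proof.
move=> lam0 Ax; apply/eqP => Fx.
have [v [Av vE]] := resolvent_spec x lam0.
move: vE; rewrite Fx => /esym/eqP; rewrite scaler_eq0 gt_eqF//= => /eqP v0.
by apply: Ax; move: Av; rewrite v0; have /eqP := Fx; rewrite subr_eq0 => /eqP <-.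
Qed.

(** In [x - y = (difference of resolvents) + d] the cross term is nonnegative by monotonicity, so
    [|d|^2 <= |x - y|^2]. *)
Lemma displacement_nonexpansive lam x y : 0 < lam ->
  `|displacement lam x - displacement lam y| <= `|x - y|.
Proof.
move=> lam0; have [v [Av vE]] := resolvent_spec x lam0.
have [w [Aw wE]] := resolvent_spec y lam0.
set d := displacement lam x - displacement lam y.
have xyE : x - y = (resolvent A lam x - resolvent A lam y) + d.
  by rewrite !resolventE addrACA -opprD !subrK.
have dE : d = lam *: (v - w) by rewrite /d vE wE scalerBr.
have h : 0 <= inner (resolvent A lam x - resolvent A lam y) d.
  by rewrite dE (innerZr innerP) mulr_ge0 ?(ltW lam0)// (innerC innerP) (Amax.1 _ _ _ _ Av Aw).
rewrite -(@ler_pXn2r _ 2)// ?nnegrE// xyE (normr_sqrD innerP _ d).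
by rewrite lerDr addr_ge0 ?sqr_ge0// mulr_ge0.
Qed.

(** The difference is [d = lam (v - w) + (lam - mu) w], and monotonicity gives
    [inner (v - w) d <= 0]; hence [|d|^2 <= (lam - mu) inner w d]. *)
Lemma displacement_index lam mu x : 0 < lam -> 0 < mu ->
  `|displacement lam x - displacement mu x| <= `|lam - mu| * `|displacement mu x| / mu.
Proof.
move=> lam0 mu0; have [v [Av vE]] := resolvent_spec x lam0.
have [w [Aw wE]] := resolvent_spec x mu0.
set d := displacement lam x - displacement mu x.
have rE : resolvent A lam x - resolvent A mu x = - d.
  by rewrite !resolventE /d !opprB addrC addrA subrK.
have dE : d = lam *: (v - w) + (lam - mu) *: w.
  by rewrite /d vE wE scalerBr scalerBl addrA subrK.
have := Amax.1 _ _ _ _ Av Aw; rewrite rE (innerNr innerP) => vw.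
have h : `|d| ^+ 2 <= (lam - mu) * inner w d.
  rewrite -(inner_norm innerP) {1}dE (innerDl innerP) !(innerZl innerP).
  by rewrite gerDr pmulr_rle0//; lra.
have -> : `|lam - mu| * `|displacement mu x| / mu = `|lam - mu| * `|w|.
  by rewrite wE normrZ gtr0_norm//; field; rewrite gt_eqF.
have [->|d0] := eqVneq d 0; first by rewrite normr0 mulr_ge0.
rewrite -(ler_pM2r (_ : 0 < `|d|)) ?normr_gt0// -expr2 (le_trans h)//.
rewrite (le_trans (ler_norm _))// normrM -mulrA ler_wpM2l//.
exact: ler_norm_inner.
Qed.

Lemma displacement_le_index lam mu x : 0 < lam -> lam <= mu ->
  `|displacement lam x| <= `|displacement mu x|.
Proof.
move=> lam0 lammu; have mu0 := lt_le_trans lam0 lammu.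
have [v [Av vE]] := resolvent_spec x lam0.
have [w [Aw wE]] := resolvent_spec x mu0.
have := Amax.1 _ _ _ _ Av Aw.
have -> : resolvent A lam x - resolvent A mu x = mu *: w - lam *: v.
  by rewrite -vE -wE !resolventE (opprB x (displacement mu x)) addrC addrA subrK.
rewrite vE wE !normrZ !gtr0_norm//.
rewrite !(innerE innerP) !(inner_norm innerP) (innerC innerP w v) => h.
have := inner_le innerP v w.
set a := `|v| in h *; set b := `|w| in h *; move=> ivw.
have a0 : 0 <= a by exact: normr_ge0.
have b0 : 0 <= b by exact: normr_ge0.
rewrite leNgt; apply/negP => ba.
(* Monotonicity and Cauchy-Schwarz combined. If the first factor were positive, then [a <= b], and
   [lam <= mu] would contradict it. *)
have : 0 <= (lam * a - mu * b) * (b - a).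
  have := ler_wpM2l (ltW (addr_gt0 lam0 mu0)) ivw; lra.
rewrite pmulr_rge0 ?subr_gt0// subr_ge0 => ab.
have : lam * a <= mu * b by rewrite ler_pM// ltW.
by rewrite leNgt ba.
Qed.

(** For [lam < mu] the constraint forces [|F mu y| <= |F lam x|], and growth in the index gives
    [|F lam y| <= |F mu y|]. The gap is thus at most [|F lam x| - |F lam y|], a comparison at one
    fixed index. *)
Lemma large_step_norm_lipschitz theta q lam mu x y :
  0 < theta -> 0 < lam -> 0 < mu ->
  lam * `|displacement lam x| ^+ q = theta ->
  mu * `|displacement mu y| ^+ q = theta ->
  `| `|displacement lam x| - `|displacement mu y| | <= `|x - y|.
Proof.
move=> theta0; wlog le_lm : lam mu x y / lam <= mu.
  move=> hw lam0 mu0 lx my; have [lm|/ltW lm] := leP lam mu; first exact: (hw _ _ _ _ lm lam0 mu0 lx my).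
  by rewrite (distrC `|_|) (distrC x y); exact: (hw _ _ _ _ lm mu0 lam0 my lx).
move=> lam0 mu0 lx my.
have lip l : 0 < l -> `|displacement l x| - `|displacement l y| <= `|x - y|.
  by move=> l0; rewrite (le_trans (lerB_dist _ _))// displacement_nonexpansive.
move: le_lm; rewrite le_eqVlt => /predU1P[lmE|lt_lm].
  by rewrite -lmE (le_trans (ler_dist_dist _ _))// displacement_nonexpansive.
have ba : `|displacement mu y| <= `|displacement lam x|.
  rewrite leNgt; apply/negP => ab.
  have aq : `|displacement lam x| ^+ q <= `|displacement mu y| ^+ q.
    by rewrite lerXn2r ?nnegrE// ltW.
  have aq0 : 0 < `|displacement lam x| ^+ q by rewrite -(pmulr_rgt0 _ lam0) lx.
  have := ler_wpM2l (ltW mu0) aq; rewrite my -lx leNgt => /negP; apply.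
  by rewrite ltr_pM2r.
rewrite ger0_norm ?subr_ge0// (le_trans _ (lip _ lam0))// lerB//.
exact/displacement_le_index/ltW.
Qed.

End Resolvent.

(** * The control as a function of the state: Lipschitz dependence and existence *)

Lemma invXn_lipschitz (R : realType) (c : R) (q : nat) : 0 < c ->
  exists K, 0 <= K /\ forall a b, c <= a -> c <= b ->
    `|(a ^+ q)^-1 - (b ^+ q)^-1| <= K * `|a - b|.
Proof.
move=> c0; elim: q => [|q [K [K0 IH]]].
  by exists 0; split=> // a b _ _; rewrite !expr0 subrr normr0 mul0r.
exists (c^-1 * K + (c ^+ q)^-1 * (c^-1 * c^-1)); split.
  have ic0 : 0 <= c^-1 by rewrite invr_ge0 ltW.
  by rewrite addr_ge0// !mulr_ge0// invr_ge0 exprn_ge0// ltW.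
move=> a b ca cb; have a0 := lt_le_trans c0 ca; have b0 := lt_le_trans c0 cb.
have -> : (a ^+ q.+1)^-1 - (b ^+ q.+1)^-1 =
    a^-1 * ((a ^+ q)^-1 - (b ^+ q)^-1) + (b ^+ q)^-1 * (a^-1 * b^-1 * (b - a)).
  by rewrite !exprS; field; rewrite !gt_eqF ?exprn_gt0.
have inv_le z : c <= z -> 0 <= z^-1 <= c^-1.
  move=> cz; have z0 := lt_le_trans c0 cz.
  by rewrite invr_ge0 ltW//= lef_pV2// posrE.
have /andP[ia0 ia] := inv_le a ca; have /andP[ib0 ib] := inv_le b cb.
rewrite (le_trans (ler_normD _ _))// mulrDl; apply: lerD.
  by rewrite -mulrA normrM (ger0_norm ia0) ler_pM// IH.
have bq : 0 <= (b ^+ q)^-1 by rewrite invr_ge0 exprn_ge0// ltW.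
rewrite -[leRHS]mulrA !normrM (ger0_norm bq) (ger0_norm ia0) (ger0_norm ib0) (distrC b a).
rewrite ler_pM ?mulr_ge0//.
  by rewrite lef_pV2 ?posrE ?exprn_gt0// lerXn2r ?nnegrE ?(ltW c0) ?(ltW b0).
by rewrite ler_wpM2r// ler_pM.
Qed.

Section LargeStep.
Context (R : realType) (H : completeNormedModType R) (inner : H -> H -> R).
Hypothesis innerP : is_inner_product inner.
Context (A : H -> set H).
Hypotheses (Amax : maximal_monotone inner A) (A_neq0 : exists a b, A a b).
Local Notation F := (displacement A).

(** The control is [theta / |F|^q], a Lipschitz function of the step length away from 0. The
    displacements are compared through [F lam y]: first the point changes, then the index. *)
Lemma large_step_lipschitz theta q c C : 0 < theta -> 0 < c ->
  exists L, 0 < L /\ forall lam mu x y, 0 < lam -> 0 < mu ->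
    lam * `|F lam x| ^+ q = theta -> mu * `|F mu y| ^+ q = theta ->
    c <= `|F lam x| -> c <= `|F mu y| <= C ->
    `|lam - mu| <= L * `|x - y| /\ `|F lam x - F mu y| <= L * `|x - y|.
Proof.
move=> theta0 c0; have [K [K0 Klip]] := invXn_lipschitz q c0.
pose D := Num.max C 0.
have D0 : 0 <= D by rewrite le_max lexx orbT.
have KD0 : 0 <= K * D ^+ q.+1 by rewrite mulr_ge0// exprn_ge0.
have tK0 : 0 <= theta * K by rewrite mulr_ge0// ltW.
(* The summands pay for moving the point, for the change of the control, and for moving the
   index. *)
exists (1 + theta * K + K * D ^+ q.+1); split; first lra.
move=> lam mu x y lam0 mu0 lx my ca /andP[cb bC].
set d := `|x - y|; have d0 : 0 <= d by exact: normr_ge0.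
set a := `|F lam x| in lx ca *; set b := `|F mu y| in my cb bC *.
have a0 := lt_le_trans c0 ca; have b0 := lt_le_trans c0 cb.
have bD : b <= D by rewrite le_max bC.
have aq0 : a ^+ q != 0 by rewrite gt_eqF// exprn_gt0.
have bq0 : b ^+ q != 0 by rewrite gt_eqF// exprn_gt0.
have lamE : lam = theta * (a ^+ q)^-1 by rewrite -lx mulfK.
have muE : mu = theta * (b ^+ q)^-1 by rewrite -my mulfK.
have lam_mu : `|lam - mu| <= theta * K * d.
  rewrite lamE muE -mulrBr normrM gtr0_norm// -mulrA ler_wpM2l ?(ltW theta0)//.
  rewrite (le_trans (Klip _ _ ca cb))// ler_wpM2l//.
  exact: (large_step_norm_lipschitz innerP Amax A_neq0 theta0 lam0 mu0 lx my).
split; first by rewrite (le_trans lam_mu)// ler_wpM2r//; lra.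
rewrite -(subrKA (F lam y)) (le_trans (ler_normD _ _))//.
have h1 := displacement_nonexpansive innerP Amax A_neq0 x y lam0.
have h2 := displacement_index innerP Amax A_neq0 y lam0 mu0.
(* The constraint turns [b / mu] into [b^(q+1) / theta], which removes the index from the bound. *)
have bmu : b / mu <= D ^+ q.+1 / theta.
  have -> : b / mu = b ^+ q.+1 / theta.
    by rewrite muE exprS; field; rewrite bq0 gt_eqF.
  by rewrite ler_pM2r ?invr_gt0// lerXn2r ?nnegrE ?(ltW b0).
have h3 : `|lam - mu| * b / mu <= K * D ^+ q.+1 * d.
  have -> : K * D ^+ q.+1 * d = theta * K * d * (D ^+ q.+1 / theta).
    by field; rewrite gt_eqF.
  by rewrite -mulrA ler_pM ?divr_ge0 ?(ltW b0) ?(ltW mu0).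
have := mulr_ge0 tK0 d0.
move: h1 h2; rewrite -/d -/b; lra.
Qed.

Lemma continuous_displacement x lam : 0 < lam ->
  {for lam, continuous (fun l => F l x)}.
Proof.
move=> lam0; apply/cvgrPdist_le => e e0.
have k0 : 0 < `|F lam x| / lam + 1 by rewrite ltr_wpDl// divr_ge0// ltW.
near=> l.
have l0 : 0 < l by near: l; exact: lt_nbhsr.
rewrite distrC (le_trans (displacement_index innerP Amax A_neq0 x l0 lam0))//.
rewrite -mulrA (le_trans (_ : _ <= `|l - lam| * (`|F lam x| / lam + 1)))//.
  by rewrite ler_wpM2l// lerDl.
rewrite -ler_pdivlMr// distrC; near: l.
by apply: cvgr_dist_le => //; rewrite divr_gt0.
Unshelve. all: by end_near. Qed.

(** Intermediate value theorem: since [|F lam x|] is nondecreasing in [lam], replacing it by its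
    value at [l1] brackets [theta] between the products at [l] and [u]. *)
Lemma large_step_exists theta q l1 x : 0 < theta -> 0 < l1 -> F l1 x != 0 ->
  exists lam, 0 < lam /\ lam * `|F lam x| ^+ q = theta.
Proof.
move=> theta0 l10 Fx; set k := `|F l1 x| ^+ q.
have k0 : 0 < k by rewrite exprn_gt0// normr_gt0.
pose l := Num.min l1 (theta / k); pose u := Num.max l1 (theta / k).
have l0 : 0 < l by rewrite lt_min l10 divr_gt0.
have l1l : l <= l1 by rewrite ge_min lexx.
have u1 : l1 <= u by rewrite le_max lexx.
have u0 : 0 < u by rewrite (lt_le_trans _ u1).
pose f lam := lam * `|F lam x| ^+ q.
have fl : f l <= theta.
  rewrite (le_trans (_ : _ <= l * k))// ?ler_wpM2l ?(ltW l0)//.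
    rewrite lerXn2r ?nnegrE//; exact: (displacement_le_index innerP Amax A_neq0).
  by rewrite -ler_pdivlMr// ge_min lexx orbT.
have fu : theta <= f u.
  rewrite (le_trans (_ : _ <= u * k))// ?ler_wpM2l ?(ltW u0)//.
    by rewrite -ler_pdivrMr// le_max lexx orbT.
  rewrite lerXn2r ?nnegrE//; exact: (displacement_le_index innerP Amax A_neq0).
have [|||lam lamlu <-] := @IVT R f l u theta.
- by rewrite (le_trans l1l).
- apply: continuous_in_subspaceT => z; rewrite inE/= in_itv/= => /andP[lz _].
  apply: cvgM => //; apply: (@continuous_comp _ _ _ (fun t => `|F t x|) (fun y => y ^+ q)); last exact: exprn_continuous.
  apply: cvg_norm; exact/continuous_displacement/(lt_le_trans l0 lz).
- by rewrite ge_min fl le_max fu orbT.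
exists lam; split=> //; rewrite (lt_le_trans l0)//.
by move: lamlu; rewrite in_itv/= => /andP[].
Qed.

End LargeStep.

(** * Derivatives within a set and the mean value inequality *)

Lemma normr_remainder (R : realType) (H : normedModType R) (f : R -> H) (s t : R) v :
  s != t -> `|f s - f t - (s - t) *: v| = `|s - t| * `|v - (s - t)^-1 *: (f s - f t)|.
Proof.
move=> st; have st0 : s - t != 0 by rewrite subr_eq0.
by rewrite distrC -normrZ scalerBr scalerA divff// scale1r.
Qed.

Lemma has_deriv_withinP (R : realType) (H : normedModType R) (D : set R)
    (f : R -> H) (t : R) (v : H) :
  has_deriv_within D f t v <->
  forall e, 0 < e -> exists2 d, 0 < d & forall s, D s -> `|s - t| < d ->
    `|f s - f t - (s - t) *: v| <= e * `|s - t|.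
Proof.
split=> [h e e0|h].
  move/cvgrPdist_le : h => /(_ e e0).
  rewrite near_withinE => /nbhs_ballP[d /= d0 hd]; exists d => // s Ds st.
  have [->|nst] := eqVneq s t; first by rewrite !subrr scale0r subr0 !normr0 mulr0.
  rewrite normr_remainder// mulrC ler_wpM2r//; apply: hd => //.
  by rewrite -ball_normE/= distrC.
apply/cvgrPdist_le => e e0; have [d d0 hd] := h e e0.
rewrite near_withinE; apply/nbhs_ballP; exists d => //= s.
rewrite -ball_normE/= distrC => st [Ds nst].
have := hd s Ds st; rewrite normr_remainder// mulrC ler_pM2r//.
by rewrite normr_gt0 subr_eq0.
Qed.

Lemma has_deriv_withinS (R : realType) (H : normedModType R) (D D' : set R)
    (f : R -> H) t v :
  D' `<=` D -> has_deriv_within D f t v -> has_deriv_within D' f t v.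
Proof.
move=> sub /has_deriv_withinP h; apply/has_deriv_withinP => e /h[d d0 hd].
by exists d => // s /sub; exact: hd.
Qed.

Lemma has_deriv_withinB (R : realType) (H : normedModType R) (D : set R)
    (f g : R -> H) t v w :
  has_deriv_within D f t v -> has_deriv_within D g t w ->
  has_deriv_within D (f \- g) t (v - w).
Proof.
move=> hf hg; rewrite /has_deriv_within.
have -> : (fun s => (s - t)^-1 *: ((f \- g) s - (f \- g) t)) =
    (fun s => (s - t)^-1 *: (f s - f t) - (s - t)^-1 *: (g s - g t)).
  by apply/funext => s; rewrite -scalerBr /= !opprD !opprK addrACA.
exact: cvgB.
Qed.

Lemma has_deriv_within_continuous (R : realType) (H : normedModType R) (D : set R)
    (f f' : R -> H) :
  (forall t, D t -> has_deriv_within D f t (f' t)) -> {within D, continuous f}.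
Proof.
move=> h; apply/subspace_continuousP => t /h /has_deriv_withinP /(_ 1 ltr01)[d d0 hd].
apply/cvgrPdist_le => e e0.
have C0 : 0 < 1 + `|f' t| by rewrite ltr_pwDl.
rewrite near_withinE; apply/nbhs_ballP; exists (Num.min d (e / (1 + `|f' t|))) => /=.
  by rewrite lt_min d0 divr_gt0.
move=> s; rewrite -ball_normE/= lt_min distrC ltr_pdivlMr// => /andP[sd se] Ds.
rewrite distrC -[f s - f t](subrK ((s - t) *: f' t)) (le_trans (ler_normD _ _))//.
have := hd s Ds sd; rewrite normrZ; lra.
Qed.

Lemma has_deriv_within_is_derive (R : realType) (a b : R) (f : R -> R) t l :
  a < t < b -> has_deriv_within `[a, b] f t l -> is_derive t 1 f l.
Proof.
move=> /andP[at0 tb] /has_deriv_withinP h.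
have cf : h^-1 *: (f (h *: 1 + t) - f t) @[h --> 0^'] --> l.
  apply/cvgrPdist_le => e e0; have [d d0 hd] := h e e0.
  rewrite near_withinE; apply/nbhs_ballP.
  exists (Num.min d (Num.min (t - a) (b - t))) => /=.
    by rewrite !lt_min d0 !subr_gt0 at0.
  move=> k; rewrite -ball_normE/= sub0r normrN !lt_min => /and3P[kd ka kb] k0.
  have := ler_norm k; have := ler_norm (- k); rewrite normrN => k1 k2.
  have := hd (k + t); rewrite addrK /= in_itv/= => /(_ _ kd) h1.
  have {}h1 := h1 ltac:(lra).
  rewrite -(ler_pM2r (_ : 0 < `|k|)) ?normr_gt0// (le_trans _ h1)//.
  rewrite -normrM distrC /GRing.scale /= mulr1 mulrBl (mulrC l).
  by rewrite mulrAC mulVf// mul1r.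
by split; [apply/cvg_ex; exists l|exact: cvg_lim].
Qed.

Lemma has_deriv_withinZ (R : realType) (H : normedModType R) (D : set R)
    (f : R -> H) (k t : R) v :
  has_deriv_within D f t v -> has_deriv_within D (k \*: f) t (k *: v).
Proof.
move=> hf; rewrite /has_deriv_within.
have -> : (fun s => (s - t)^-1 *: ((k \*: f) s - (k \*: f) t)) =
    (fun s => k *: ((s - t)^-1 *: (f s - f t))).
  by apply/funext => s; rewrite /= -scalerBr !scalerA mulrC.
exact: cvgZl_tmp.
Qed.

Lemma has_deriv_within_mvt (R : realType) (D : interval R) (a b : R) (g g' : R -> R) :
  a <= b -> `[a, b] `<=` [set` D] ->
  (forall t, t \in D -> has_deriv_within [set` D] g t (g' t)) ->
  exists2 c, c \in `[a, b] & g b - g a = g' c * (b - a).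
Proof.
move=> ab sub hg.
have {}hg t : t \in `[a, b] -> has_deriv_within `[a, b] g t (g' t).
  by move=> /sub/hg; exact: has_deriv_withinS.
apply: MVT_segment => // [t|].
  rewrite in_itv/= => tab; apply: (has_deriv_within_is_derive tab).
  by apply: hg; rewrite in_itv/=; move/andP: tab => [/ltW-> /ltW->].
exact: has_deriv_within_continuous hg.
Qed.

Section MeanValue.
Context (R : realType) (H : completeNormedModType R) (inner : H -> H -> R).
Hypothesis innerP : is_inner_product inner.

Lemma has_deriv_within_inner D (f : R -> H) t v e : has_deriv_within D f t v ->
  has_deriv_within D (fun s => inner (f s) e) t (inner v e).
Proof.
move=> /has_deriv_withinP h; apply/has_deriv_withinP => eps eps0.
have C0 : 0 < `|e| + 1 by rewrite ltr_wpDl.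
have [|d d0 hd] := h (eps / (`|e| + 1)); first by rewrite divr_gt0.
exists d => // s Ds /(hd s Ds) {}hd.
have -> : inner (f s) e - inner (f t) e - (s - t) *: inner v e =
    inner (f s - f t - (s - t) *: v) e by rewrite !(innerE innerP).
rewrite (le_trans (ler_norm_inner innerP _ _))//.
rewrite (le_trans (ler_wpM2r (normr_ge0 e) hd))//.
rewrite mulrAC ler_wpM2r// mulrAC ler_pdivrMr// ler_wpM2l ?(ltW eps0)//.
by rewrite lerDl.
Qed.

(** The scalar mean value theorem is applied to the component of [w] along the increment
    [w b - w a]; Cauchy-Schwarz then lets one factor [|w b - w a|] cancel. *)
Lemma mean_value_le (a b K : R) (w w' : R -> H) : a <= b ->
  (forall t, t \in `[a, b] -> has_deriv_within `[a, b] w t (w' t)) ->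
  (forall t, t \in `[a, b] -> `|w' t| <= K) ->
  `|w b - w a| <= K * (b - a).
Proof.
move=> ab hw wK.
set e := w b - w a.
have hg t : t \in `[a, b] ->
    has_deriv_within `[a, b] (fun s => inner (w s) e) t (inner (w' t) e).
  by move=> /hw; exact: has_deriv_within_inner.
have [c cab gE] := has_deriv_within_mvt ab (@subset_refl _ _) hg.
have : `|e| ^+ 2 <= K * (b - a) * `|e|.
  rewrite -(inner_norm innerP) {1}/e (innerDl innerP) (innerNl innerP) gE.
  rewrite mulrAC ler_wpM2r ?subr_ge0// (le_trans (inner_le innerP _ _))//.
  by rewrite ler_wpM2r// wK.
have [->|e0] := eqVneq e 0; last by rewrite expr2 ler_pM2r// normr_gt0.
have K0 : 0 <= K by apply: le_trans (wK a _) => //; rewrite in_itv/= lexx.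
by rewrite normr0 mulr_ge0// subr_ge0.
Qed.

End MeanValue.

(** * Primitives of Lipschitz vector-valued functions *)

Lemma is_derive_has_deriv_within (R : realType) (H : normedModType R) (D : set R)
    (f : R -> H) (t : R) (v : H) : is_derive t 1 f v -> has_deriv_within D f t v.
Proof.
case=> df fv; apply/has_deriv_withinP => e e0.
have /cvgrPdist_le : h^-1 *: ((f \o shift t) (h *: 1) - f t) @[h --> 0^'] --> v.
  by rewrite -fv; exact: df.
move=> /(_ e e0); rewrite near_withinE => /nbhs_ballP[d /= d0 hd].
exists d => // s _ st; have [->|nst] := eqVneq s t.
  by rewrite !subrr scale0r subr0 !normr0 mulr0.
have := hd (s - t); rewrite -ball_normE/= sub0r normrN subr_eq0 => /(_ st nst).
rewrite [_ *: 1]mulr1 subrK => h.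
by rewrite normr_remainder// mulrC ler_wpM2r.
Qed.

Lemma continuous_primitive (R : realType) (T : R) (g : R -> R) : continuous g ->
  exists phi, phi 0 = 0 /\
    forall t, t \in `[0, T] -> has_deriv_within `[0, T] phi t (g t).
Proof.
move=> cg.
(* Integration starts at -1 so that the endpoint [t = 0] is also interior for the fundamental
   theorem. *)
pose G x := \int[lebesgue_measure]_(s in `[-1, x]) g s.
exists (fun x => G x - G 0); split; first by rewrite subrr.
move=> t; rewrite in_itv/= => /andP[t0 _].
have [|||dG GE] := @continuous_FTC1 R g (BLeft (-1)) t (t + 1) _ _ _ (cg t).
- by rewrite ltrDl.
- apply: continuous_compact_integrable; first exact: segment_compact.
  exact: continuous_subspaceT.
- by suff : -1 < t; last lra.
apply: is_derive_has_deriv_within.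
suff -> : (fun x => G x - G 0) = G - cst (G 0).
  by rewrite -[g t]subr0; apply: is_deriveB; split; rewrite // -derive1E.
by apply/funext.
Qed.

Lemma lipschitz_continuous (R : realType) (V : normedModType R) (f : R -> V) (K : R) :
  (forall s t, `|f s - f t| <= K * `|s - t|) -> continuous f.
Proof.
move=> fK t; apply/cvgrPdist_le => e e0; near=> s.
have K0 : 0 <= K by have := le_trans (normr_ge0 _) (fK 1 0); rewrite subr0 normr1 mulr1.
have : `|t - s| <= e / (K + 1).
  near: s; apply: cvgr_dist_le; first exact: cvg_id.
  rewrite divr_gt0//; have := le_trans (normr_ge0 _) (fK 1 0); rewrite subr0 normr1; lra.
rewrite ler_pdivlMr ?ltr_wpDl// => h.
by have := fK t s; have := normr_ge0 (t - s); lra.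
Unshelve. all: by end_near. Qed.

Section Primitive.
Context (R : realType) (H : completeNormedModType R) (inner : H -> H -> R).
Hypothesis innerP : is_inner_product inner.

Lemma inner_inj (x y : H) : (forall z, inner x z = inner y z) -> x = y.
Proof.
move=> h; apply/eqP; rewrite -subr_eq0 -normr_eq0 -sqrf_eq0 -(inner_norm innerP).
by rewrite (innerDl innerP) (innerNl innerP) h subrr.
Qed.

(* The scalar primitives of [inner (f s) e] are linear and bounded in [e], so Riesz
   representation replaces vector-valued integration. *)
Lemma lipschitz_primitive (f : R -> H) (L M T : R) : 0 <= T -> 0 <= L ->
  (forall s t, `|f s - f t| <= L * `|s - t|) -> (forall t, `|f t| <= M) ->
  exists F, F 0 = 0 /\ forall t, t \in `[0, T] -> has_deriv_within `[0, T] F t (f t).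
Proof.
move=> T0 L0 fL fM.
have M0 : 0 <= M := le_trans (normr_ge0 _) (fM 0).
have cf e : continuous (fun s => inner (f s) e).
  move=> s; apply: (cvg_inner innerP); last exact: cvg_cst.
  exact: lipschitz_continuous fL _.
have /choice[phi phiP] e := continuous_primitive T (cf e).
have phi_mvt e s t : s \in `[0, T] -> t \in `[0, T] ->
    exists c, `|c - t| <= `|s - t| /\ phi e s - phi e t = (s - t) * inner (f c) e.
  move=> sT tT.
  have seg a b : a \in `[0, T] -> b \in `[0, T] -> `[a, b]%classic `<=` `[0, T]%classic.
    rewrite !in_itv/= => /andP[a0 _] /andP[_ bT] c /=; rewrite !in_itv/= => /andP[ac cb].
    by rewrite (le_trans a0)// (le_trans cb).
  have [ts|/ltW st] := leP t s.
    have [c] := has_deriv_within_mvt ts (seg _ _ tT sT) (phiP e).2.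
    rewrite in_itv/= => /andP[tc cs] ->; exists c; split; last by rewrite mulrC.
    by rewrite !ger0_norm ?subr_ge0// lerB.
  have [c] := has_deriv_within_mvt st (seg _ _ sT tT) (phiP e).2.
  rewrite in_itv/= => /andP[sc ct] cE; exists c; split; last lra.
  by rewrite !(distrC _ t) !ger0_norm ?subr_ge0// lerB.
have T00 : 0 \in `[0, T] by rewrite in_itv/= lexx.
have phi_lin a e1 e2 t : t \in `[0, T] ->
    phi (a *: e1 + e2) t = a * phi e1 t + phi e2 t.
  move=> tT; have t0 : 0 <= t by move: tT; rewrite in_itv/= => /andP[].
  (* The defect of linearity vanishes at 0 and has zero derivative. *)
  pose psi := phi (a *: e1 + e2) \- (a \*: phi e1) \- phi e2.
  have hpsi u : u \in `[0, T] -> has_deriv_within `[0, T] psi u 0.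
    move=> uT.
    rewrite [X in has_deriv_within _ _ _ X](_ : 0 =
      inner (f u) (a *: e1 + e2) - a * inner (f u) e1 - inner (f u) e2).
      apply: has_deriv_withinB; last exact: (phiP e2).2 u uT.
      apply: has_deriv_withinB; first exact: (phiP _).2 u uT.
      by apply: has_deriv_withinZ; exact: (phiP e1).2 u uT.
    by rewrite (innerDr innerP) (innerZr innerP); lra.
  have sub : `[0, t]%classic `<=` `[0, T]%classic.
    move=> c /=; rewrite !in_itv/= => /andP[-> ct] /=.
    by rewrite (le_trans ct)//; move: tT; rewrite in_itv/= => /andP[].
  have [c _] := has_deriv_within_mvt t0 sub hpsi.
  rewrite mul0r /psi /= !(phiP _).1 /GRing.scale/= mulr0; lra.
have /choice[F FP] t : exists v, t \in `[0, T] -> forall e, phi e t = inner v e.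
  have [tT|nT] := boolP (t \in `[0, T]); last by exists 0.
  have [||v vE] := @riesz R H inner innerP (phi^~ t) (`|t| * M).
    by move=> a x y; exact: phi_lin.
    move=> x; have [c [_]] := phi_mvt x t 0 tT T00.
    rewrite (phiP _).1 !subr0 => ->.
    rewrite (le_trans (ler_norm _))// normrM -mulrA ler_wpM2l//.
    by rewrite (le_trans (ler_norm_inner innerP _ _))// ler_wpM2r.
  by exists v.
exists F; split.
  by apply: inner_inj => e; rewrite -FP// (phiP e).1 (inner0l innerP).
move=> t tT; apply/has_deriv_withinP => eps eps0.
have L1 : 0 < L + 1 by lra.
exists (eps / (L + 1)); first by rewrite divr_gt0.
move=> s sT; rewrite ltr_pdivlMr// => st.
have [z zE] : exists z, z = F s - F t - (s - t) *: f t by eexists.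
rewrite -zE.
have [->|z0] := eqVneq z 0; first by rewrite normr0 mulr_ge0// ltW.
have [c [cs cE]] := phi_mvt z s t sT tT.
rewrite -(ler_pM2r (_ : 0 < `|z|)) ?normr_gt0// -expr2 -(inner_norm innerP).
(* Pairing the remainder with itself reduces the estimate to a scalar mean value, with
   [|f c - f t| <= L * |s - t|]. *)
have -> : inner z z = (s - t) * inner (f c - f t) z.
  by rewrite {1}zE !(innerE innerP) -(FP s sT) -(FP t tT); lra.
rewrite (le_trans (ler_norm _))// normrM (mulrC eps) -mulrA ler_wpM2l//.
rewrite (le_trans (ler_norm_inner innerP _ _))// ler_wpM2r//.
rewrite (le_trans (fL _ _))// (le_trans (ler_wpM2l L0 cs))//.
have := normr_ge0 (s - t); lra.
Qed.

End Primitive.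

(** * Picard iteration and a substitute for Gronwall's inequality *)

Lemma le_of_vanishing (R : realType) (a c : R) (b : nat -> R) :
  b n @[n --> \oo] --> 0 -> (forall n, a <= c + b n) -> a <= c.
Proof.
move=> b0 h; have cb : c + b n @[n --> \oo] --> c.
  by rewrite -[X in _ --> X]addr0; apply: cvgD => //; exact: cvg_cst.
by apply: ler_cvg_to (cvg_cst a) cb _; near=> n; exact: h.
Unshelve. all: by end_near. Qed.

Section Picard.
Context (R : realType) (H : completeNormedModType R) (inner : H -> H -> R).
Hypothesis innerP : is_inner_product inner.
Context (G : H -> H) (x0 : H) (r L M T : R).
Hypotheses (T0 : 0 <= T) (L0 : 0 <= L) (M0 : 0 <= M) (r0 : 0 <= r).
Hypotheses (TL : T * L <= 2^-1) (TM : T * M <= r).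
Hypothesis Glip : forall x y, `|x - x0| <= r -> `|y - x0| <= r ->
  `|G x - G y| <= L * `|x - y|.
Hypothesis Gbound : forall x, `|x - x0| <= r -> `|G x| <= M.

(** The ball condition keeps the bounds on [G] available along [u]; the Lipschitz condition gives
    [G \o u] a primitive. Both pass to pointwise limits. *)
Let admissible (u : R -> H) :=
  (forall t, `|u t - x0| <= r) /\ (forall s t, `|u s - u t| <= M * `|s - t|).

(* Functions are extended to [R] by their boundary values, so that the Lipschitz
   bounds hold on the whole line. *)
Let clamp t := Num.max 0 (Num.min t T).

Let clampT t : clamp t \in `[0, T].
Proof. by rewrite in_itv/= le_max lexx/= ge_max T0 ge_min lexx orbT. Qed.

Let clamp_id t : t \in `[0, T] -> clamp t = t.
Proof. by rewrite in_itv/= /clamp => /andP[t0 tT]; rewrite (min_idPl tT) (max_idPr t0). Qed.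

Let clamp_lipschitz s t : `|clamp s - clamp t| <= `|s - t|.
Proof.
wlog st : s t / s <= t.
  by move=> hw; have [/hw//|/ltW/hw] := leP s t; rewrite distrC (distrC t).
rewrite distrC (distrC s t) (ger0_norm (_ : 0 <= t - s)) ?subr_ge0//.
rewrite /clamp /Num.max /Num.min.
by case: ifP; case: ifP; case: ifP; case: ifP; rewrite ler_norml; lra.
Qed.

(** Relational form of the Picard operator: [w] is [x0] plus the integral of [G (u s)] from 0,
    frozen outside [[0, T]]. *)
Let is_step (u w : R -> H) :=
  [/\ w 0 = x0, (forall t, w t = w (clamp t)) &
      forall t, t \in `[0, T] -> has_deriv_within `[0, T] w t (G (u t))].

Let subseg (a b : R) : a \in `[0, T] -> b \in `[0, T] ->
  `[a, b]%classic `<=` `[0, T]%classic.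
Proof.
rewrite !in_itv/= => /andP[a0 _] /andP[_ bT] c /=; rewrite !in_itv/= => /andP[ac cb].
by rewrite (le_trans a0)// (le_trans cb).
Qed.

Let T00 : 0 \in `[0, T]. Proof. by rewrite in_itv/= lexx. Qed.

Let lipschitz_of_deriv K (w w' : R -> H) :
  (forall t, t \in `[0, T] -> has_deriv_within `[0, T] w t (w' t)) ->
  (forall t, t \in `[0, T] -> `|w' t| <= K) ->
  forall s t, s \in `[0, T] -> t \in `[0, T] -> `|w s - w t| <= K * `|s - t|.
Proof.
move=> hw wK s t; wlog ts : s t / t <= s.
  move=> hwl sT tT; have [ts|/ltW st] := leP t s; first exact: hwl.
  by rewrite distrC (distrC s); exact: hwl.
move=> sT tT; have sub := subseg tT sT.
rewrite (ger0_norm (_ : 0 <= s - t)) ?subr_ge0//.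
apply: (mean_value_le innerP (w' := w') ts) => u /sub uT; last exact: wK.
by apply: has_deriv_withinS sub _; exact: hw.
Qed.

Let step_exists u : admissible u -> exists w, is_step u w.
Proof.
move=> [ur uM].
have [|||F [F0 hF]] := @lipschitz_primitive _ _ _ innerP (G \o u) (L * M) M T T0.
- exact: mulr_ge0.
- by move=> s t /=; rewrite (le_trans (Glip _ _))// -mulrA ler_wpM2l.
- by move=> t; exact: Gbound.
exists (fun t => x0 + F (clamp t)); split.
- by rewrite clamp_id// F0 addr0.
- by move=> t; rewrite (clamp_id (clampT t)).
- move=> t tT; apply/has_deriv_withinP => e e0.
  have /has_deriv_withinP /(_ e e0)[d d0 hd] := hF t tT.
  exists d => // s sT st; rewrite !clamp_id// opprD addrACA subrr add0r.
  exact: hd.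
Qed.

Let step_admissible u w : admissible u -> is_step u w -> admissible w.
Proof.
move=> [ur _] [w0 wE hw].
have wlip := lipschitz_of_deriv hw (fun t _ => Gbound (ur t)).
split=> [t|s t].
  rewrite -w0 wE (le_trans (wlip _ _ (clampT t) T00))// subr0.
  rewrite (le_trans _ TM)// mulrC ler_wpM2r//.
  by have := clampT t; rewrite in_itv/= => /andP[c0 cT]; rewrite ger0_norm.
rewrite wE (wE t) (le_trans (wlip _ _ (clampT s) (clampT t)))//.
by rewrite ler_wpM2l ?clamp_lipschitz.
Qed.

(** The derivatives differ by at most [L * k], and integration over a length at most [T] costs the
    factor [T * L <= 1 / 2]. *)
Let step_contracts u v w z k : admissible u -> admissible v ->
  is_step u w -> is_step v z -> (forall t, `|u t - v t| <= k) ->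
  forall t, `|w t - z t| <= 2^-1 * k.
Proof.
move=> [ur _] [vr _] [w0 wE hw] [z0 zE hz] uvk t; rewrite wE zE.
have hd s : s \in `[0, T] -> has_deriv_within `[0, T] (w \- z) s (G (u s) - G (v s)).
  by move=> sT; apply: has_deriv_withinB; [exact: hw|exact: hz].
have hb s : s \in `[0, T] -> `|G (u s) - G (v s)| <= L * k.
  by move=> _; rewrite (le_trans (Glip _ _))// ler_wpM2l.
have k0 : 0 <= k by exact: le_trans (uvk 0).
have := lipschitz_of_deriv hd hb (clampT t) T00.
rewrite /= w0 z0 subrr !subr0 => /le_trans; apply.
rewrite mulrAC ler_wpM2r// (le_trans _ TL)// mulrC ler_wpM2r//.
by have := clampT t; rewrite in_itv/= => /andP[c0 cT]; rewrite ger0_norm.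
Qed.

Lemma picard_lindelof : exists x : R -> H,
  [/\ x 0 = x0, (forall t, `|x t - x0| <= r),
      (forall s t, `|x s - x t| <= M * `|s - t|) &
      forall t, t \in `[0, T] -> has_deriv_within `[0, T] x t (G (x t))].
Proof.
have /choice[Phi PhiP] u : exists w, admissible u -> is_step u w.
  have [ua|nua] := pselect (admissible u); last by exists u.
  by have [w wP] := step_exists ua; exists w.
pose X n := iter n Phi (cst x0).
have X0 : admissible (cst x0).
  by split=> [t|s t]; rewrite /= subrr normr0 ?mulr_ge0.
have Xadm n : admissible (X n).
  by elim: n => //= n IH; apply: (step_admissible IH); exact: PhiP.
(* All iterates lie within [r] of the constant start, and each step halves the gap. *)
pose b n := r * 2^-1 ^+ n.
have b0 : b n @[n --> \oo] --> 0.
  rewrite -(mulr0 r); apply: cvgMr; apply: cvg_expr.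
  by rewrite ger0_norm; lra.
have Xdist n k t : `|X n t - X (n + k)%N t| <= b n.
  elim: n t => [|n IH] t.
    by rewrite /b expr0 mulr1 distrC; case: (Xadm k) => h _; exact: h.
  rewrite /b exprS mulrCA; apply: step_contracts IH t; [exact: Xadm|exact: Xadm| |];
    exact/PhiP/Xadm.
have /choice[x xP] t : exists l, forall n, `|X n t - l| <= b n.
  have [|l [_ lP]] := @cvgn_rate _ _ (fun n => X n t) b b0; last by exists l.
  by move=> n k nk; rewrite -(subnKC nk).
have vanish c : c * b n @[n --> \oo] --> 0 by rewrite -(mulr0 c); exact: cvgMr.
have xadm : admissible x.
  split=> [t|s t].
    apply: (le_of_vanishing b0) => n.
    have := ler_distD (X n t) (x t) x0; have := (Xadm n).1 t.
    by have := xP t n; rewrite (distrC (X n t) (x t)); lra.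
  apply: (le_of_vanishing (vanish 2)) => n.
  have := ler_distD (X n s) (x s) (x t); have := ler_distD (X n t) (X n s) (x t).
  have := (Xadm n).2 s t; have := xP t n; have := xP s n.
  by rewrite (distrC (X n s) (x s)); lra.
have step := PhiP x xadm.
(* [Phi x] is within [b n / 2] of [X n.+1], which itself tends to [x]. *)
have xE : Phi x = x.
  apply/funext => t; apply/eqP; rewrite -subr_eq0 -normr_le0.
  apply: (le_of_vanishing (vanish 1)) => n.
  have h : `|Phi x t - X n.+1 t| <= 2^-1 * b n.
    apply: step_contracts xadm (Xadm n) step (PhiP _ (Xadm n)) _ t => s.
    by rewrite distrC.
  have := xP t n.+1; rewrite {1}/b exprS mulrCA -/(b n).
  by have := ler_distD (X n.+1 t) (Phi x t) (x t); lra.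
move: step; rewrite xE => -[x_0 _ hx].
by exists x; split=> //; [exact: xadm.1|exact: xadm.2].
Qed.

End Picard.

(** At a maximum point [c] of [|w|] the mean value inequality gives [|w c| <= (a + k |w c|) T <= a T
    + |w c| / 2]. It serves both to confine solutions and, with [a = 0], to identify them. *)
Lemma deriv_le_affine_bound (R : realType) (H : completeNormedModType R)
    (inner : H -> H -> R) (innerP : is_inner_product inner) (T a k : R) (w w' : R -> H) :
  0 <= T -> 0 <= a -> 0 <= k -> T * k <= 2^-1 -> w 0 = 0 ->
  (forall t, t \in `[0, T] -> has_deriv_within `[0, T] w t (w' t)) ->
  (forall t, t \in `[0, T] -> `|w' t| <= a + k * `|w t|) ->
  forall t, t \in `[0, T] -> `|w t| <= 2 * (a * T).
Proof.
move=> T0 a0 k0 Tk w0 hw wb t tT.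
have cw : {within `[0, T], continuous (fun s => `|w s|)}.
  have /subspace_continuousP h := has_deriv_within_continuous hw.
  by apply/subspace_continuousP => s sT; apply: cvg_norm; exact: h.
have [c cT wc] := EVT_max T0 cw.
have /andP[c0 cleT] : 0 <= c <= T by move: cT; rewrite in_itv.
have sub : `[0, c]%classic `<=` `[0, T]%classic.
  by move=> s /=; rewrite !in_itv/= => /andP[-> sc] /=; rewrite (le_trans sc).
have : `|w c - w 0| <= (a + k * `|w c|) * (c - 0).
  apply: (mean_value_le innerP (w' := w') c0) => s /sub sT.
    by apply: has_deriv_withinS sub _; exact: hw.
  by rewrite (le_trans (wb s sT))// lerD2l ler_wpM2l// wc.
rewrite w0 !subr0 => wcle; have := wc t tT.
have : (a + k * `|w c|) * c <= (a + k * `|w c|) * T.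
  by rewrite ler_wpM2l// addr_ge0// mulr_ge0.
have := ler_wpM2r (normr_ge0 (w c)) Tk; lra.
Qed.

Lemma has_deriv_within_cst (R : realType) (H : normedModType R) (D : set R) (x : H) t :
  has_deriv_within D (cst x) t 0.
Proof.
apply/has_deriv_withinP => e e0; exists 1 => // s _ _.
by rewrite /= subrr scaler0 subr0 normr0 mulr_ge0// ltW.
Qed.

(** * The closed-loop system: reduction to an autonomous equation, existence, uniqueness *)

Unset Implicit Arguments.

Theorem theorem2p1 (R : realType) (H : completeNormedModType R)
  (inner : H -> H -> R) (Hinner : is_inner_product inner)
  (A : H -> set H) (HA : maximal_monotone inner A)
  (Hzero : exists z : H, A z 0)
  (theta : R) (Htheta : 0 < theta) (p : nat) (Hp : (0 < p)%N)
  (x0 : H) (Hx0 : ~ A x0 0) :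
  exists t0 : R, 0 < t0 /\
  exists (x : R -> H) (lam : R -> R),
    (* (x, lam) is a solution on [0, t0], with x continuously differentiable *)
    (exists x' : R -> H,
       (forall t, t \in `[0, t0] -> has_deriv_within `[0, t0] x t (x' t)) /\
       {within `[0, t0], continuous x'} /\
       (forall t, t \in `[0, t0] ->
          [/\ x' t + x t - resolvent A (lam t) (x t) = 0,
              0 < lam t &
              lam t * `|resolvent A (lam t) (x t) - x t| ^+ p.-1 = theta]) /\
       x 0 = x0) /\
    (* lam is locally Lipschitz continuous on [0, t0] *)
    (forall t, t \in `[0, t0] -> exists e L : R, 0 < e /\
       forall s u, s \in `[0, t0] -> u \in `[0, t0] ->
         `|s - t| < e -> `|u - t| < e ->
         `|lam s - lam u| <= L * `|s - u|) /\
    (* uniqueness among differentiable solutions on [0, t0] *)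
    (forall (y : R -> H) (mu : R -> R),
       (exists y' : R -> H,
          (forall t, t \in `[0, t0] -> has_deriv_within `[0, t0] y t (y' t)) /\
          (forall t, t \in `[0, t0] ->
             [/\ y' t + y t - resolvent A (mu t) (y t) = 0,
                 0 < mu t &
                 mu t * `|resolvent A (mu t) (y t) - y t| ^+ p.-1 = theta]) /\
          y 0 = x0) ->
       forall t, t \in `[0, t0] -> y t = x t /\ mu t = lam t).
Proof.
have A_neq0 : exists a b, A a b by case: Hzero => z Az; exists z, 0.
set q := p.-1; pose F := displacement A.
have [lam0 [lam0_gt0 lam0E]] := large_step_exists Hinner HA A_neq0 q Htheta ltr01
  (displacement_neq0 Hinner HA A_neq0 ltr01 Hx0).
pose a0 := `|F lam0 x0|.
have a0_gt0 : 0 < a0.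
  by rewrite normr_gt0; exact: (displacement_neq0 Hinner HA A_neq0 lam0_gt0 Hx0).
pose solves lam x := 0 < lam /\ lam * `|F lam x| ^+ q = theta.
have norm_F lam x : solves lam x -> `| `|F lam x| - a0 | <= `|x - x0|.
  move=> [l0 lE].
  exact: (large_step_norm_lipschitz Hinner HA A_neq0 Htheta l0 lam0_gt0 lE lam0E).
have F_le lam x : solves lam x -> `|F lam x| <= a0 + `|x - x0|.
  by move=> /norm_F; rewrite ler_norml => /andP[_]; lra.
have F_ge lam x : solves lam x -> a0 - `|x - x0| <= `|F lam x|.
  by move=> /norm_F; rewrite ler_norml => /andP[+ _]; lra.
(* On the ball of radius [a0 / 2] nonexpansiveness keeps [F lam0 x] away from 0, so a control exists
   there; elsewhere the value is arbitrary. *)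
have /choice[Lam LamP] x : exists lam, `|x - x0| <= a0 / 2 -> solves lam x.
  have [xr|nxr] := boolP (`|x - x0| <= a0 / 2); last by exists 0.
  have Fx : F lam0 x != 0.
    rewrite -normr_gt0.
    have := displacement_nonexpansive Hinner HA A_neq0 x0 x lam0_gt0.
    have := ler_dist_dist (F lam0 x0) (F lam0 x).
    rewrite -/F -/a0 (distrC x0 x) ler_norml => /andP[_] h1 h2; lra.
  have [lam lamP] := large_step_exists Hinner HA A_neq0 q Htheta lam0_gt0 Fx.
  by exists lam.
have a2 : 0 < a0 / 2 by lra.
(* On this ball step lengths lie between [a0 / 2] and [3 * a0 / 2]. *)
have [L [L0 Lip]] := large_step_lipschitz Hinner HA A_neq0 q (3 * a0 / 2) Htheta a2.
have {}Lip lam mu x y : solves lam x -> solves mu y ->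
    `|x - x0| <= a0 / 2 -> `|y - x0| <= a0 / 2 ->
    `|lam - mu| <= L * `|x - y| /\ `|F lam x - F mu y| <= L * `|x - y|.
  move=> sx sy xr yr; have := F_ge _ _ sx; have := F_ge _ _ sy; have := F_le _ _ sy.
  move=> h1 h2 h3; move: sx sy => [l0 lE] [m0 mE].
  by apply: Lip => //; rewrite -/F; lra.
pose G x := - F (Lam x) x.
have G_lip x y : `|x - x0| <= a0 / 2 -> `|y - x0| <= a0 / 2 -> `|G x - G y| <= L * `|x - y|.
  move=> xr yr; rewrite /G -opprD normrN.
  by have [] := Lip _ _ _ _ (LamP x xr) (LamP y yr) xr yr.
have G_le x : `|x - x0| <= a0 / 2 -> `|G x| <= 3 * a0 / 2.
  by move=> xr; rewrite normrN; have := F_le _ _ (LamP x xr); lra.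
(* The bound [1 / 4] keeps both the Picard solution, of speed at most [3 * a0 / 2], and any other
   solution, via [2 * (a0 * T)], in the ball; the other bound makes the iteration contract. *)
pose T := Num.min (4^-1) (2 * L)^-1.
have T0 : 0 < T by rewrite lt_min !invr_gt0; lra.
have T4 : T <= 4^-1 by rewrite ge_min lexx.
have TL : T * L <= 2^-1.
  have -> : 2^-1 = (2 * L)^-1 * L by field; rewrite gt_eqF.
  by rewrite ler_pM2r// ge_min lexx orbT.
have [|||x [x_0 xr xlip hx]] := @picard_lindelof R H inner Hinner G x0 (a0 / 2) L
  (3 * a0 / 2) T (ltW T0) (ltW L0) _ _ TL _ G_lip G_le; [lra|lra|nra|].
exists T; split=> //; exists x, (fun t => Lam (x t)).
have solves_x t := LamP _ (xr t).
have normE lam z : `|resolvent A lam z - z| = `|F lam z| by rewrite distrC.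
split; last split.
- exists (G \o x); split=> //; split; last split=> // t _.
    apply/continuous_subspaceT/(@lipschitz_continuous _ _ _ (L * (3 * a0 / 2))) => s t /=.
    by rewrite (le_trans (G_lip _ _ _ _))// -(mulrA L) ler_wpM2l// ltW.
  have [l0 lE] := solves_x t; split=> //; last by rewrite normE.
  by rewrite /= -addrA addNr.
- move=> t _; exists 1, (L * (3 * a0 / 2)); split=> // s u _ _ _ _.
  have [+ _] := Lip _ _ _ _ (solves_x s) (solves_x u) (xr s) (xr u).
  by move=> /le_trans; apply; rewrite -(mulrA L) ler_wpM2l// ltW.
move=> y mu [y' [hy [yeq y_0]]] t tT.
have y'E s : s \in `[0, T] -> y' s = - F (mu s) (y s).
  by move=> /yeq[+ _ _]; rewrite -addrA => /eqP; rewrite addr_eq0 => /eqP.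
have solves_y s : s \in `[0, T] -> solves (mu s) (y s).
  by move=> /yeq[_ m0]; rewrite normE.
(* The growth bound [|F| <= a0 + |y - x0|] holds even outside the ball, so confinement is not
   presupposed. *)
have yr s : s \in `[0, T] -> `|y s - x0| <= a0 / 2.
  move=> sT.
  have := @deriv_le_affine_bound _ _ _ Hinner T a0 1 (y \- cst x0) (fun s => y' s - 0).
  move=> /(_ (ltW T0) (ltW a0_gt0) ler01) h.
  have : `|y s - x0| <= 2 * (a0 * T).
    apply: h sT => [|/=|u uT|u uT]; first lra.
    - by rewrite y_0 subrr.
    - by apply: has_deriv_withinB; [exact: hy|exact: has_deriv_within_cst].
    - by rewrite subr0 mul1r y'E// normrN; exact/F_le/solves_y.
  nra.
(* Both trajectories now lie where the field is Lipschitz, so the bound with [a = 0] makes their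
   difference vanish. *)
have yx : y t = x t.
  have := @deriv_le_affine_bound _ _ _ Hinner T 0 L (y \- x) (fun s => y' s - G (x s)).
  move=> /(_ (ltW T0) (lexx _) (ltW L0) TL) h.
  have : `|y t - x t| <= 2 * (0 * T).
    apply: h tT => [/=|u uT|u uT].
    - by rewrite y_0 x_0 subrr.
    - by apply: has_deriv_withinB; [exact: hy|exact: hx].
    - rewrite add0r y'E// /G -opprD normrN.
      by have [] := Lip _ _ _ _ (solves_y u uT) (solves_x u) (yr u uT) (xr u).
  by rewrite mul0r mulr0 normr_le0 subr_eq0 => /eqP.
split=> //.
(* The Lipschitz estimate at coinciding states forces the controls to agree. *)
have [+ _] := Lip _ _ _ _ (solves_y t tT) (solves_x t) (yr t tT) (xr t).
by rewrite yx subrr normr0 mulr0 normr_le0 subr_eq0 => /eqP.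
Qed.
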